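(* Among all non cycle balanced unicyclic sidigraphs on $n$ vertices ($n\ge 2$), the negative cycle $\mathbf{C}_n$ has the largest energy, i.e. $E(S)\le E(\mathbf{C}_n)$ for every such sidigraph $S$. Moreover, the energy of negative cycles increases monotonically with respect to the order: $E(\mathbf{C}_m)<E(\mathbf{C}_n)$ whenever $2\le m<n$. Minimal energy is attained by $\mathbf{C}_2$, the negative cycle of order $2$.
   Context: A sidigraph (signed digraph) is a pair $S=(D,\sigma)$, where $D=(V,\mathscr{A})$ is a digraph (without loops) and $\sigma:\mathscr{A}\to\{-1,1\}$. Its adjacency matrix $A(S)=(a_{ij})$ has $a_{ij}=\sigma(v_i,v_j)$ if there is an arc from $v_i$ to $v_j$ and $0$ otherwise. The energy of $S$ is $E(S)=\sum_{j=1}^n|\Re z_j|$, where $z_1,\dots,z_n$ are the eigenvalues of $A(S)$ with multiplicity. Cycles are directed cycles (of length at least $2$); a sidigraph is unicyclic if it has exactly one directed cycle. The sign of a cycle is the product of the signs of its arcs. A sidigraph is cycle balanced if each of its cycles is positive, and non cycle balanced otherwise. $\mathbf{C}_n$ denotes a negative directed cycle on $n$ vertices (the sidigraph consisting of a directed cycle of length $n$ with an odd number of negative arcs). *)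

(* Defs.v *)
From mathcomp Require Import all_boot all_order all_algebra.
From mathcomp Require Import complex reals.

Set Implicit Arguments.
Unset Strict Implicit.
Unset Printing Implicit Defensive.

Import Order.TTheory GRing.Theory Num.Theory.
Local Open Scope ring_scope.

(* The values of [sigma] outside the arcs are junk: they are unconstrained here
   and no definition below reads them. *)
Record sidigraph (n : nat) := Sidigraph {
  arc : rel 'I_n;
  sigma : 'I_n -> 'I_n -> int;
  arc_irr : irreflexive arc;
  sigma_arc : forall u v, arc u v -> sigma u v = 1 \/ sigma u v = -1
}.

Definition adjmx (n : nat) (S : sidigraph n) : 'M[int]_n :=
  \matrix_(i, j) (if arc S i j then sigma S i j else 0).

Definition eigenvalues (R : realType) (n : nat) (A : 'M[R[i]]_n) : seq R[i] :=
  sval (closed_field_poly_normal (char_poly A)).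

Lemma eigenvaluesP (R : realType) (n : nat) (A : 'M[R[i]]_n) :
  char_poly A = \prod_(z <- eigenvalues A) ('X - z%:P).
Proof.
rewrite /eigenvalues; case: closed_field_poly_normal => r /= {1}->.
by rewrite (eqP (char_poly_monic A)) scale1r.
Qed.

Definition energy (R : realType) (n : nat) (S : sidigraph n) : R :=
  \sum_(z <- eigenvalues (map_mx intr (adjmx S) : 'M[R[i]]_n)) `|complex.Re z|.

Arguments energy R {n} S.

(* A directed cycle v_0 -> v_1 -> ... -> v_(k-1) -> v_0 is given by the sequence
   of its distinct vertices. Two such sequences describe the same cycle iff they
   are rotations of each other. *)
Definition dicycle (n : nat) (S : sidigraph n) (c : seq 'I_n) : bool :=
  [&& (1 < size c)%N, cycle (arc S) c & uniq c].

Definition unicyclic (n : nat) (S : sidigraph n) : Prop :=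
  exists2 c, dicycle S c &
    forall c', dicycle S c' -> exists k, c' = rot k c.

Definition cycle_sign (n : nat) (S : sidigraph n) (c : seq 'I_n) : int :=
  \prod_(v <- c) sigma S v (next c v).

Definition cycle_balanced (n : nat) (S : sidigraph n) : Prop :=
  forall c, dicycle S c -> cycle_sign S c = 1.

(* The negative cycle bold C_n is only determined up to relabelling of the
   vertices and the choice of the (oddly many) negative arcs, hence a predicate:
   [c] runs through all n vertices and there are no further arcs. *)
Definition negative_cycle (n : nat) (S : sidigraph n) : Prop :=
  exists c : seq 'I_n,
    [/\ dicycle S c,
        forall v, v \in c,
        forall u v, arc S u v = (v == next c u)
      & odd (count (fun v => sigma S v (next c v) == -1) c)].

(* Main.v *)
Require Import Defs.
From mathcomp Require Import all_boot all_order all_algebra.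
From mathcomp Require Import fingroup perm zify ring lra.
From mathcomp Require Import complex reals topology normedtype derive trigo.

Set Implicit Arguments.
Unset Strict Implicit.
Unset Printing Implicit Defensive.

Import Order.TTheory GRing.Theory Num.Theory numFieldNormedType.Exports.
Local Open Scope ring_scope.

(** In the Leibniz expansion of the characteristic polynomial of a unicyclic
    sidigraph only the identity and the permutation turning the unique cycle
    survive. If that cycle has length [m] and sign [-1], the polynomial is
    [X^n + X^(n-m)], so the energy is the sum [E m] of the [|cos((2j+1)pi/m)|]
    for [j < m], whatever the rest of the sidigraph. All claims thus amount to
    [E 2 <= E m < E (m+1)].

    With [a = pi/m], [2 sin a |cos((2j+1)a)|] is the absolute increment of [sin]
    from [2ja] to [2(j+1)a], so [2 sin a E m] is the total variation of the
    sampled sine: [E m] is [2/sin a], [1/sin(a/2)] or [2 cot a] for [m] divisible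
    by 4, odd, or [2] modulo 4. The steps to [m+1] from [m = 2, 3] modulo 4
    follow from monotonicity of sine and cosine alone; the other two need
    the bounds [sin x >= x - 3x^3/16] and [pi < 3.17]. *)

(** * Bounds for sine, cosine and pi *)

Section Trigonometry.
Variable R : realType.
Implicit Types x y : R.

(** The mean value theorem writes [sin x] as [cos c * x] with [c] in [[0, x]], and cosine decreases
    on [[0, pi]]. *)
Lemma sin_bounds x : 0 <= x <= pi -> x * cos x <= sin x <= x.
Proof.
move=> /andP[x0 xpi]; have [] := @MVT_segment R sin cos 0 x x0.
  by apply: continuous_subspaceT; exact: continuous_sin.
move=> c /[!in_itv]/= /andP[c0 cx]; rewrite sin0 !subr0 => ->.
rewrite mulrC ler_wpM2r//=; first by rewrite -[leRHS]mul1r ler_wpM2r// cos_le1.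
have [->//|cltx] := eqVneq c x.
by rewrite ltW// ltr_cos ?in_itv/= ?c0 ?x0 ?xpi ?(le_trans cx)// lt_neqAle cltx.
Qed.

(** [cos x = 1 - 2 sin^2 (x/2)], and [sin (x/2) <= x/2]. *)
Lemma cos_ge x : 0 <= x <= pi -> 1 - x ^+ 2 / 2 <= cos x.
Proof.
move=> /andP[x0 xpi]; have -> : x = x / 2 *+ 2 by rewrite mulr2n; lra.
set y := x / 2; have y0 : 0 <= y by rewrite /y; lra.
have : 0 <= y <= pi by have := pi_ge0 R; rewrite y0 /y /=; lra.
move=> ypi; have /andP[_ sy] := sin_bounds ypi.
have sy0 := sin_ge0_pi ypi.
by rewrite cos_mulr2n cos2sin2; nra.
Qed.

Lemma sin_double x : sin x = 2 * sin (x / 2) * cos (x / 2).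
Proof.
rewrite {1}(_ : x = x / 2 *+ 2); last by rewrite mulr2n; lra.
by rewrite sin_mulr2n; lra.
Qed.

(** Doubling twice gives [sin x = 4 cos(2y) cos y sin y] with [y = x/4]. Multiplying the bounds
    [cos(2y) >= 1 - 2y^2] and [cos y sin y >= y cos^2 y >= y (1 - y^2)] yields the claimed bound
    plus [8 y^5]. *)
Lemma sin_ge x : 0 <= x <= 2 -> x * (1 - 3 / 16 * x ^+ 2) <= sin x.
Proof.
move=> /andP[x0 x2].
have pi2 := pi_ge2 R.
pose y := x / 4.
have y0 : 0 <= y by rewrite /y; lra.
have y12 : y <= 1/2 by rewrite /y; lra.
have ypi : 0 <= y <= pi by apply/andP; split; lra.
have y2pi : 0 <= y *+ 2 <= pi by rewrite mulr2n; apply/andP; split; lra.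
have x4 : x = 4 * y by rewrite /y; lra.
have -> : sin x = 4 * (cos (y *+ 2) * (cos y * sin y)).
  have -> : x = y *+ 2 *+ 2 by rewrite (mulr2n (y *+ 2)) (mulr2n y) /y; lra.
  by rewrite !sin_mulr2n (mulr2n (_ * _)) (mulr2n (cos y * _)); lra.
have /andP[s1 s2] := sin_bounds ypi.
have c1 := cos_ge ypi.
have c2 := cos_ge y2pi.
have s0 := sin_ge0_pi ypi.
have e2 : cos y ^+ 2 = 1 - sin y ^+ 2 by exact: cos2sin2.
have h1 : y * (1 - y ^+ 2) <= cos y * sin y.
  have : 0 <= cos y * (sin y - y * cos y) by apply: mulr_ge0; nra.
  by nra.
have h2 : 0 <= y * (1 - y ^+ 2) by nra.
have h3 : 0 <= 1 - 2 * y ^+ 2 by nra.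
have h4 : (1 - 2 * y ^+ 2) * (y * (1 - y ^+ 2)) <= cos (y *+ 2) * (cos y * sin y).
  by apply: ler_pM => //; apply: le_trans c2; rewrite (mulr2n y); lra.
have h5 : 0 <= y ^+ 5 by exact: exprn_ge0.
rewrite x4; lra.
Qed.

(** [sin(pi/6) = 1/2] since [sin(2t) = cos t] at [t = pi/6]; compare [sin_ge]. *)
Lemma pi_lt : pi < 317 / 100 :> R.
Proof.
rewrite ltNge; apply/negP => hpi.
pose t : R := 317/600.
have pi0 := pi_gt0 R.
have p2 := pihalf_lt2 R.
have s6 : sin (pi / 6) = 1 / 2 :> R.
  have c0 : 0 < cos (pi / 6) :> R by apply: cos_gt0_pihalf; apply/andP; split; lra.
  have : sin (pi / 6 *+ 2) = cos (pi / 6) :> R.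
    by rewrite -cosBpihalf -cosN; congr cos; rewrite mulr2n; lra.
  rewrite sin_mulr2n mulr2n => e; apply: (mulfI (lt0r_neq0 c0)); lra.
have : sin t <= sin (pi / 6).
  have [<-//|tp] := eqVneq t (pi / 6).
  rewrite ltW// ltr_sin ?in_itv/= ?lt_neqAle ?tp /t; try (apply/andP; split); lra.
have : 0 <= t <= 2 by rewrite /t; lra.
move/sin_ge; rewrite s6 /t; lra.
Qed.

(** * Closed forms of [E m] *)

Definition negative_cycle_energy (m : nat) : R :=
  \sum_(0 <= j < m) `|cos (j.*2.+1%:R * (pi / m%:R))|.
Local Notation E := negative_cycle_energy.

Lemma cos_ge0_le_pihalf x : 0 <= x <= pi / 2 -> 0 <= cos x.
Proof. by move=> ?; apply: cos_ge0_pihalf; have := pi_gt0 R; lra. Qed.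

Lemma cos_le0_pihalf x : pi / 2 <= x <= 3 * pi / 2 -> cos x <= 0.
Proof.
move=> h; rewrite -[x](subrK pi) cosDpi oppr_le0; apply: cos_ge0_pihalf; lra.
Qed.

(** [q] counts the [j] with [(2j+1)pi/m < pi/2]; the cosine is nonnegative for
    [j < q] and [m - q <= j], nonpositive in between. *)
Lemma negative_cycle_energyE m (q := ((m.+1) %/ 4)%N) : (1 < m)%N ->
  E m = 2 * sin (q.*2%:R * (pi / m%:R)) / sin (pi / m%:R).
Proof.
move=> m1; have m0 : 0 < m%:R :> R by rewrite ltr0n; lia.
have m2 : 2 <= m%:R :> R by rewrite ler_nat.
have pi0 := pi_gt0 R.
set a := pi / m%:R.
have ma : m%:R * a = pi by rewrite /a mulrC divfK// gt_eqF.
have a0 : 0 < a by rewrite divr_gt0.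
have sa : 0 < sin a by apply: sin_gt0_pi; apply/andP; split=> //; nra.
pose G (j : nat) := sin (j.*2%:R * a).
have GS j : 2 * sin a * cos (j.*2.+1%:R * a) = G j.+1 - G j.
  rewrite /G; have -> : j.+1.*2%:R * a = j.*2.+1%:R * a + a.
    by rewrite doubleS -(natr1 j.*2.+1); lra.
  have -> : j.*2%:R * a = j.*2.+1%:R * a - a.
    by rewrite -(natr1 j.*2); lra.
  rewrite sinD sinB; lra.
(* As [m * a = pi], replacing [j] by [m - j] reflects the sampled angle in a full turn. *)
have Gm j : (j <= m)%N -> G (m - j)%N = - G j.
  move=> jm; rewrite /G -sinN doubleB natrB ?leq_double//.
  rewrite mulrBl -[m.*2]addnn natrD mulrDl ma -[RHS]sinD2pi; congr sin.
  by rewrite mulr2n; lra.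
(* These equivalences turn the sign conditions on the cosine into integer inequalities. *)
have half (k : nat) : k%:R * a <= pi / 2 <-> (k.*2 <= m)%N.
  rewrite -(ler_nat R) -addnn natrD; split; nra.
have ihalf (k : nat) : pi / 2 <= k%:R * a <-> (m <= k.*2)%N.
  rewrite -(ler_nat R) -addnn natrD; split; nra.
have i3half (k : nat) : k%:R * a <= 3 * pi / 2 <-> (k.*2 <= 3 * m)%N.
  rewrite -(ler_nat R) -addnn natrD natrM; split; nra.
have ka0 (k : nat) : 0 <= k%:R * a by rewrite mulr_ge0 ?ler0n// ltW.
have sumG (i k : nat) : (i <= k)%N -> forall e : R,
    {in index_iota i k, forall j, `|cos (j.*2.+1%:R * a)| = e * cos (j.*2.+1%:R * a)} ->
    2 * sin a * \sum_(i <= j < k) `|cos (j.*2.+1%:R * a)| = e * (G k - G i).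
  move=> ik e he; rewrite -telescope_sumr// !mulr_sumr; apply: eq_big_seq => j jik.
  by rewrite he// mulrCA GS.
have qm : (q <= m - q)%N by rewrite /q; lia.
have lowE : 2 * sin a * \sum_(0 <= j < q) `|cos (j.*2.+1%:R * a)| = 1 * (G q - G 0).
  apply: sumG => // j; rewrite mem_index_iota => jq; rewrite mul1r ger0_norm//.
  by apply: cos_ge0_le_pihalf; rewrite ka0; apply/half; lia.
have midE : 2 * sin a * \sum_(q <= j < m - q) `|cos (j.*2.+1%:R * a)|
     = (-1) * (G (m - q)%N - G q).
  apply: sumG => // j; rewrite mem_index_iota => jq; rewrite mulN1r ler0_norm//.
  by apply: cos_le0_pihalf; apply/andP; split; [apply/ihalf|apply/i3half]; lia.
have highE : 2 * sin a * \sum_(m - q <= j < m) `|cos (j.*2.+1%:R * a)|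
     = 1 * (G m - G (m - q)%N).
  apply: sumG => [|j]; first lia.
  rewrite mem_index_iota => jq; rewrite mul1r ger0_norm//.
  have jm : (m - j.+1 < q)%N by lia.
  (* Reflection in a full turn sends the index [j] to [m - j.+1], which lies in the first range. *)
  rewrite -cosN -cosD2pi.
  have -> : - (j.*2.+1%:R * a) + pi *+ 2 = (m - j.+1).*2.+1%:R * a.
    have -> : pi *+ 2 = m.*2%:R * a by rewrite -addnn natrD mulrDl ma mulr2n.
    rewrite addrC -mulrBl -natrB; last lia.
    by congr (_%:R * _); lia.
  by apply: cos_ge0_le_pihalf; rewrite ka0; apply/half; lia.
have G0 : G 0%N = 0 by rewrite /G mul0r sin0.
have Gm0 : G m = 0 by rewrite -[m]subn0 Gm// G0 oppr0.
have -> : E m = \sum_(0 <= j < q) `|cos (j.*2.+1%:R * a)| +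
   \sum_(q <= j < m - q) `|cos (j.*2.+1%:R * a)| +
   \sum_(m - q <= j < m) `|cos (j.*2.+1%:R * a)|.
  by rewrite -!big_cat_nat //=; lia.
have Gmq := Gm q _; rewrite Gmq in midE highE *; [|lia..].
(* Multiplied by [2 sin a], the three ranges contribute [G q], [2 G q] and [G q]. *)
apply: (mulIf (lt0r_neq0 sa)); rewrite divfK ?gt_eqF//.
rewrite G0 Gm0 in lowE highE; rewrite -/(G q); lra.
Qed.

(** With [t = pi/(2m)], the angle in [negative_cycle_energyE] is [pi/2 - t] or [pi/2 + t], according
    to [m] modulo 4. Its sine is [cos t] either way, which cancels in [sin(2t) = 2 sin t cos t]. *)
Lemma negative_cycle_energy_odd m : odd m -> (1 < m)%N ->
  E m = (sin (pi / (2 * m%:R)))^-1.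
Proof.
move=> om m1; have m2 : 2 <= m%:R :> R by rewrite ler_nat.
have pi0 := pi_gt0 R; pose t : R := pi / (2 * m%:R).
have mt : m%:R * t = pi / 2 by rewrite /t; field; lra.
have t0 : 0 < t by apply: divr_gt0 => //; lra.
have tp : t <= pi / 4 by nra.
have s0 : 0 < sin t by apply: sin_gt0_pi; lra.
have c0 : 0 < cos t by apply: cos_gt0_pihalf; lra.
rewrite negative_cycle_energyE//; set q := ((m.+1) %/ 4)%N.
have e2 : pi / m%:R = 2 * t by rewrite /t; field; lra.
rewrite e2 [sin (2 * t)]sin_double (_ : 2 * t / 2 = t) -/t; last lra.
have -> : sin (q.*2%:R * (2 * t)) = cos t.
  have [m4|m4] : (q.*2.*2.+1 = m \/ q.*2.*2 = m.+1)%N by rewrite /q; lia.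
    rewrite -[cos t]cosN -sinDpihalf; congr sin; rewrite -mt -m4.
    rewrite -(natr1 (q.*2.*2)) -(addnn q.*2) natrD; lra.
  rewrite -sinDpihalf; congr sin; rewrite -mt.
  have -> : q.*2%:R * (2 * t) = m.+1%:R * t by rewrite -m4 -(addnn q.*2) natrD; lra.
  by rewrite -(natr1 m); lra.
by field; lra.
Qed.

(** Here [m = 4q], so the sampled sine reaches its maximum exactly, at [pi/2]. *)
Lemma negative_cycle_energy4k m : (4 %| m)%N -> (1 < m)%N ->
  E m = 2 / sin (pi / m%:R).
Proof.
move=> m4 m1; have m2 : 2 <= m%:R :> R by rewrite ler_nat.
rewrite negative_cycle_energyE//; set q := ((m.+1) %/ 4)%N.
have qm : m = q.*2.*2 by rewrite /q; lia.
have e : m%:R = q.*2%:R * 2 :> R by rewrite qm -(addnn q.*2) natrD; lra.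
have -> : q.*2%:R * (pi / m%:R) = pi / 2 :> R.
  have -> : q.*2%:R = m%:R / 2 :> R by lra.
  by clear qm; field; lra.
by rewrite sin_pihalf mulr1.
Qed.

(** Here [m = 4q + 2], and the angle falls short of [pi/2] by [pi/m]. *)
Lemma negative_cycle_energy4k2 m : (m %% 4 = 2)%N ->
  E m = 2 * cos (pi / m%:R) / sin (pi / m%:R).
Proof.
move=> m4; have m1 : (1 < m)%N by lia.
have m2 : 2 <= m%:R :> R by rewrite ler_nat.
rewrite negative_cycle_energyE//; set q := ((m.+1) %/ 4)%N.
have qm : m = q.*2.*2.+2 by rewrite /q; lia.
rewrite -[cos _]cosN -sinDpihalf; congr (_ * sin _ / _).
have e : m%:R = q.*2%:R * 2 + 2 :> R.
  by rewrite qm -addn2 natrD -(addnn q.*2) natrD; lra.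
have -> : q.*2%:R = m%:R / 2 - 1 :> R by lra.
by clear qm m4; field; lra.
Qed.

(** * Growth of [E] from [m] to [m + 1], by residue modulo 4 *)

Lemma ler_sin x y : 0 <= x -> x <= y -> y <= pi / 2 -> sin x <= sin y.
Proof.
move=> x0 xy yp; have [<-//|xy'] := eqVneq x y.
by have := pi_gt0 R => pi0; rewrite ltW// ltr_sin ?in_itv/= ?lt_neqAle ?xy'; lra.
Qed.

(** The claim is [2 sin y < sin x]. Since [2y = x (1 - 1/(m+1))], it suffices that the gap [1/(m+1)]
    exceeds the relative error [3x^2/16] of [sin_ge]. *)
Lemma negative_cycle_energy_ltS_mod0 m : (m %% 4 = 0)%N -> (1 < m)%N ->
  E m < E m.+1.
Proof.
move=> em m1; have m2 : 2 <= m%:R :> R by rewrite ler_nat.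
have pi0 := pi_gt0 R; have pi3 := pi_lt; have pi2 := pi_ge2 R.
have mS : m.+1%:R = m%:R + 1 :> R by rewrite natr1.
have m4 : 4 <= m%:R :> R by rewrite ler_nat; lia.
rewrite negative_cycle_energy4k ?/dvdn ?em// negative_cycle_energy_odd; try lia.
rewrite mS {em}; set M : R := m%:R in m2 m4 mS *.
set x := pi / M; set y := pi / (2 * (M + 1)).
have Mx : M * x = pi by rewrite /x; field; lra.
have My : 2 * (M + 1) * y = pi by rewrite /y; field; lra.
have x0 : 0 < x by apply: divr_gt0; lra.
have y0 : 0 < y by apply: divr_gt0; lra.
have x1 : x <= 1 by nra.
have y1 : y <= 1 by nra.
have sx : 0 < sin x by apply: sin_gt0_pi; lra.
have sy : 0 < sin y by apply: sin_gt0_pi; lra.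
rewrite ltr_pdivrMr// ltr_pdivlMl//.
have /andP[_ sy1] : y * cos y <= sin y <= y by apply: sin_bounds; lra.
have sx1 : x * (1 - 3 / 16 * x ^+ 2) <= sin x by apply: sin_ge; lra.
have : 2 * y < x * (1 - 3 / 16 * x ^+ 2) ; last lra.
have -> : 2 * y = x * (1 - (M + 1)^-1) by rewrite /x /y; field; lra.
rewrite ltr_pM2l//.
have : 3 / 16 * x ^+ 2 < (M + 1)^-1; last lra.
rewrite -[ltRHS]mul1r ltr_pdivlMr; last lra.
(* [M >= 4] gives [M + 1 <= 5M/4]. *)
have : (M + 1) * x <= 5 / 4 * pi by nra.
nra.
Qed.

(** The claim is [sin z < 2 sin y cos z]. Since [z = 2y (1 - 1/(m+1))], the gap [1/(m+1)] now has to
    cover the errors of both [sin_ge] and [cos_ge]. *)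
Lemma negative_cycle_energy_ltS_mod1 m : (m %% 4 = 1)%N -> (1 < m)%N ->
  E m < E m.+1.
Proof.
move=> em m1; have m2 : 2 <= m%:R :> R by rewrite ler_nat.
have pi0 := pi_gt0 R; have pi3 := pi_lt; have pi2 := pi_ge2 R.
have mS : m.+1%:R = m%:R + 1 :> R by rewrite natr1.
have m4 : 5 <= m%:R :> R by rewrite ler_nat; lia.
rewrite negative_cycle_energy_odd ?negative_cycle_energy4k2; try lia.
rewrite mS {em}; set M : R := m%:R in m2 m4 mS *.
set z := pi / (M + 1); set y := pi / (2 * M).
have Mz : (M + 1) * z = pi by rewrite /z; field; lra.
have My : 2 * M * y = pi by rewrite /y; field; lra.
have z0 : 0 < z by apply: divr_gt0; lra.
have y0 : 0 < y by apply: divr_gt0; lra.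
have z1 : z <= 1 by nra.
have y1 : y <= 1 by nra.
have sz : 0 < sin z by apply: sin_gt0_pi; lra.
have sy : 0 < sin y by apply: sin_gt0_pi; lra.
rewrite ltr_pdivlMr// mulrC ltr_pdivrMr//.
have /andP[_ sz1] : z * cos z <= sin z <= z by apply: sin_bounds; lra.
have sy1 : y * (1 - 3 / 16 * y ^+ 2) <= sin y by apply: sin_ge; lra.
have cz : 1 - z ^+ 2 / 2 <= cos z by apply: cos_ge; lra.
have : z < 2 * y * ((1 - 3 / 16 * y ^+ 2) * (1 - z ^+ 2 / 2)).
  rewrite [ltLHS](_ : z = 2 * y * (1 - (M + 1)^-1)); last by rewrite /z /y; field; lra.
  rewrite ltr_pM2l; last lra.
  (* These bounds come from [M >= 5]. Multiplied by [M + 1], the two errors sum to at most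
     [pi^2/12 + pi^2/80], which is below 1 when [pi^2 < 10.1]. *)
  have z6 : z <= pi / 6 by nra.
  have y10 : y <= pi / 10 by nra.
  have h1 : (M + 1) * (z ^+ 2 / 2) <= pi ^+ 2 / 12 by nra.
  have h2 : (M + 1) * y <= 6 / 10 * pi by nra.
  have h3 : (M + 1) * (3 / 16 * y ^+ 2) <= pi ^+ 2 / 80 by nra.
  have pi9 : pi ^+ 2 < 101 / 10 :> R by nra.
  have : 3 / 16 * y ^+ 2 + z ^+ 2 / 2 < (M + 1)^-1.
    by rewrite -[ltRHS]mul1r ltr_pdivlMr; lra.
  have : 0 <= 3 / 16 * y ^+ 2 * (z ^+ 2 / 2) by apply: mulr_ge0; nra.
  lra.
have : y * (1 - 3 / 16 * y ^+ 2) * (1 - z ^+ 2 / 2) <= sin y * cos z.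
  by apply: ler_pM => //; nra.
lra.
Qed.

(** The claim is [sin y cos x < sin(x/2) cos(x/2)], which holds factor by factor because
    [y < x/2 < x]. *)
Lemma negative_cycle_energy_ltS_mod2 m : (m %% 4 = 2)%N -> (1 < m)%N ->
  E m < E m.+1.
Proof.
move=> em m1; have m2 : 2 <= m%:R :> R by rewrite ler_nat.
have pi0 := pi_gt0 R; have pi3 := pi_lt; have pi2 := pi_ge2 R.
have mS : m.+1%:R = m%:R + 1 :> R by rewrite natr1.
rewrite negative_cycle_energy4k2// negative_cycle_energy_odd; try lia.
rewrite mS {em}; set M : R := m%:R in m2 mS *.
set x := pi / M; set y := pi / (2 * (M + 1)).
have Mx : M * x = pi by rewrite /x; field; lra.
have My : 2 * (M + 1) * y = pi by rewrite /y; field; lra.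
have x0 : 0 < x by apply: divr_gt0; lra.
have y0 : 0 < y by apply: divr_gt0; lra.
have yx : y < x / 2 by nra.
have xpi : x <= pi / 2 by nra.
have sx : 0 < sin x by apply: sin_gt0_pi; lra.
have sx2 : 0 < sin (x / 2) by apply: sin_gt0_pi; lra.
have cx2 : 0 < cos (x / 2) by apply: cos_gt0_pihalf; lra.
have sy : 0 < sin y by apply: sin_gt0_pi; lra.
rewrite ltr_pdivrMr// ltr_pdivlMl// [sin x]sin_double.
have syx : sin y <= sin (x / 2) by apply: ler_sin; lra.
have cxc : cos x < cos (x / 2) by rewrite ltr_cos ?in_itv/=; lra.
have cx : 0 <= cos x by apply: cos_ge0_pihalf; lra.
have : sin y * cos x <= sin (x / 2) * cos x by rewrite ler_wpM2r.
have : sin (x / 2) * cos x < sin (x / 2) * cos (x / 2) by rewrite ltr_pM2l.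
lra.
Qed.

(** The claim is [sin x < 2 sin y]; it follows from [sin x = 2 sin(x/2) cos(x/2) < 2 sin(x/2)] and
    [x/2 < y]. *)
Lemma negative_cycle_energy_ltS_mod3 m : (m %% 4 = 3)%N -> (1 < m)%N ->
  E m < E m.+1.
Proof.
move=> em m1; have m2 : 2 <= m%:R :> R by rewrite ler_nat.
have pi0 := pi_gt0 R; have pi3 := pi_lt; have pi2 := pi_ge2 R.
have mS : m.+1%:R = m%:R + 1 :> R by rewrite natr1.
rewrite negative_cycle_energy_odd ?negative_cycle_energy4k; try lia.
rewrite mS {em}; set M : R := m%:R in m2 mS *.
set x := pi / (M + 1); set y := pi / (2 * M).
have Mx : (M + 1) * x = pi by rewrite /x; field; lra.
have My : 2 * M * y = pi by rewrite /y; field; lra.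
have x0 : 0 < x by apply: divr_gt0; lra.
have y0 : 0 < y by apply: divr_gt0; lra.
have yx : x / 2 < y by nra.
have xpi : x <= pi / 2 by nra.
have sx : 0 < sin x by apply: sin_gt0_pi; lra.
have sx2 : 0 < sin (x / 2) by apply: sin_gt0_pi; lra.
have cx2 : 0 < cos (x / 2) by apply: cos_gt0_pihalf; lra.
have sy : 0 < sin y by apply: sin_gt0_pi; nra.
rewrite ltr_pdivlMr// mulrC ltr_pdivrMr// [sin x]sin_double.
have syx : sin (x / 2) <= sin y by apply: ler_sin; nra.
have cx1 : cos (x / 2) < 1 by rewrite -[ltRHS](cos0 R) ltr_cos ?in_itv/=; lra.
have : sin (x / 2) * cos (x / 2) < sin (x / 2) * 1 by rewrite ltr_pM2l.
lra.
Qed.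

Lemma negative_cycle_energy_ltS m : (1 < m)%N -> E m < E m.+1.
Proof.
have : (m %% 4 < 4)%N by rewrite ltn_mod.
case em : (m %% 4)%N => [|[|[|[|//]]]] _.
- exact: negative_cycle_energy_ltS_mod0.
- exact: negative_cycle_energy_ltS_mod1.
- exact: negative_cycle_energy_ltS_mod2.
- exact: negative_cycle_energy_ltS_mod3.
Qed.

Lemma negative_cycle_energy_lt m n : (1 < m)%N -> (m < n)%N -> E m < E n.
Proof.
move=> m1; elim: n => // n IH; rewrite ltnS leq_eqVlt => /predU1P[<-|mn].
  exact: negative_cycle_energy_ltS.
by apply: lt_trans (IH mn) _; apply: negative_cycle_energy_ltS; lia.
Qed.

Lemma negative_cycle_energy_le m n : (1 < m)%N -> (m <= n)%N -> E m <= E n.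
Proof.
move=> m1; rewrite leq_eqVlt => /predU1P[->//|mn].
by rewrite ltW// negative_cycle_energy_lt.
Qed.

End Trigonometry.

(** * The permutation turning a duplicate-free sequence *)

Lemma uniq_size_ord n (p : seq 'I_n) : uniq p -> (size p <= n)%N.
Proof. by move=> Up; rewrite -[leqRHS]card_ord -(card_uniqP Up) max_card. Qed.

Lemma next_notin (T : eqType) (p : seq T) x : x \notin p -> next p x = x.
Proof. by rewrite next_nth => /negbTE ->. Qed.

Lemma next_neq (T : eqType) (p : seq T) x :
  uniq p -> (1 < size p)%N -> x \in p -> next p x != x.
Proof.
move=> Up sp /rot_to[i q pE]; rewrite -(next_rot i Up) pE.
have := Up; rewrite -(rot_uniq i) pE.
have := sp; rewrite -(size_rot i) pE.
case: q {pE} => //= y q _; rewrite eqxx inE negb_or => /andP[/andP[xy _] _].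
by rewrite eq_sym.
Qed.

Section NextPerm.
Variables (T : finType) (p : seq T) (Up : uniq p).

(** Since [next p] fixes every point outside [p], it is a permutation of all of [T]. *)
Definition next_perm : {perm T} := perm (can_inj (prev_next Up)).

Lemma next_permE : next_perm =1 next p.
Proof. exact: permE. Qed.

Lemma fcycle_next_perm : fcycle next_perm p.
Proof. by rewrite (eq_fcycle next_permE); exact: cycle_next. Qed.

Lemma porbit_next_perm x : x \in p -> porbit next_perm x = [set y in p].
Proof.
move=> px; apply/setP => y; rewrite inE -(fconnect_cycle fcycle_next_perm px).
apply/porbitP/idP => [[i ->]|/iter_findex <-]; first by rewrite permX fconnect_iter.
by exists (findex next_perm x y); rewrite permX.
Qed.

Lemma porbit_next_perm_notin x : x \notin p -> porbit next_perm x = [set x].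
Proof.
move=> px; apply/setP => y; rewrite inE; apply/porbitP/eqP => [[i ->]|->].
  by rewrite permX; elim: i => //= i ->; rewrite next_permE next_notin.
by exists 0%N; rewrite expg0 perm1.
Qed.

(** The parity of a permutation is that of [#|T|] plus its number of orbits; here the orbits are [p]
    and the singletons outside [p]. *)
Lemma odd_next_perm : (0 < size p)%N -> odd_perm next_perm = ~~ odd (size p).
Proof.
move=> sp; pose P : {set T} := [set y in p].
have [x0 x0p] : exists x, x \in p by case: (p) sp => // x q _; exists x; exact: mem_head.
have cP : #|P| = size p by rewrite cardsE; apply/card_uniqP.
have -> : odd_perm next_perm = odd #|T| (+) odd #|porbits next_perm| by [].
have -> : porbits next_perm = P |: [set [set x] | x in ~: P].
  apply/setP => A; rewrite in_setU1; apply/imsetP/predU1P => [[x _ ->]|].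
    have [xp|xp] := boolP (x \in p); first by left; rewrite porbit_next_perm.
    by right; rewrite porbit_next_perm_notin//; apply: imset_f; rewrite !inE.
  case=> [->|/imsetP[x]]; first by exists x0; rewrite ?porbit_next_perm.
  by rewrite !inE => xp ->; exists x; rewrite ?porbit_next_perm_notin.
rewrite cardsU1 card_imset; last exact: set1_inj.
have -> : P \notin [set [set x] | x in ~: P].
  apply/imsetP => -[x]; rewrite inE => xP PE; move: xP.
  by rewrite PE inE eqxx.
by rewrite -(cardsC P) cP add1n /= oddD; do 2!case: (odd _).
Qed.

End NextPerm.

(** * The Leibniz expansion for a unicyclic sidigraph *)

Section CharPoly.
Variables (n : nat) (S : sidigraph n) (c : seq 'I_n).
Hypothesis dc : dicycle S c.
Hypothesis uc : forall c', dicycle S c' -> exists k, c' = rot k c.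

Let Uc : uniq c. Proof. by case/and3P: dc. Qed.
Let c1 : (1 < size c)%N. Proof. by case/and3P: dc. Qed.
Let ac : {in c, forall x, Defs.arc S x (next c x)}.
Proof. by case/and3P: dc => _ cc _ x; exact: next_cycle. Qed.

(** The orbit of a moved point is a directed cycle, hence a rotation of [c]. So [s] agrees with
    [next c] on [c] and fixes everything else. *)
Lemma perm_arc_next (s : 'S_n) :
  (forall i, s i != i -> Defs.arc S i (s i)) -> s = 1%g \/ s = next_perm Uc.
Proof.
move=> sarc; have [->|s1] := eqVneq s 1%g; [by left|right].
have key x : s x != x -> x \in c /\ {in c, s =1 next c}.
  move=> sx; have injs := @perm_inj _ s.
  have fc : fcycle s (orbit s x) by exact: cycle_orbit.
  have [] // := uc (c' := orbit s x).
    apply/and3P; split; last exact: orbit_uniq.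
      rewrite size_orbit ltnNge; apply: contra sx => o1.
      have := iter_order injs x; have := fingraph.order_gt0 s x.
      by case: (fingraph.order s x) o1 => [|[|]] //= _ _ ->.
    apply: (@sub_in_cycle _ (fun y => s y != y) _ _ _ _ _ fc).
      by move=> y z sy _ /eqP <-; exact: sarc.
    (* If an iterate of [x] were fixed, injectivity of [s] would carry this back to [x]. *)
    apply/allP => y; rewrite -fconnect_orbit => /iter_findex <-.
    by apply: contra sx; elim: (findex s x y) => //= i IH /eqP/injs/eqP.
  move=> k ek; split; first by rewrite -(mem_rot k) -ek in_orbit.
  move=> y yc; rewrite -(next_rot k Uc) -ek; apply/esym/(nextE fc).
  by rewrite ek mem_rot.
have [x sx] : exists x, s x != x.
  apply/existsP; apply: contraNT s1; rewrite negb_exists => /forallP h.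
  by apply/eqP/permP => x; rewrite perm1; apply/eqP; rewrite -[_ == _]negbK.
have [_ sc] := key x sx.
apply/permP => y; rewrite next_permE.
have [yc|yc] := boolP (y \in c); first exact: sc.
rewrite next_notin//; apply/eqP; apply: contraNT yc => /key; tauto.
Qed.

Lemma char_poly_unicyclic :
  char_poly (adjmx S) = 'X^n - (cycle_sign S c)%:P * 'X^(n - size c).
Proof.
have s01 : next_perm Uc != 1%g.
  case: c Uc c1 => // x q Uq q1.
  apply: contraNneq (next_neq Uq q1 (mem_head x q)) => e.
  by rewrite -(next_permE Uq) e perm1.
rewrite /char_poly /determinant (bigD1 1%g)//= (bigD1 (next_perm Uc))//=.
(* Any other permutation moves some point along a non-arc, where the matrix entry vanishes. *)
rewrite [X in _ + (_ + X)]big1; last first.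
  move=> s /andP[s1 s2].
  have [i si] : exists i, (s i != i) && ~~ Defs.arc S i (s i).
    apply/existsP; apply: contraNT s1; rewrite negb_exists => /forallP h.
    have sarc i : s i != i -> Defs.arc S i (s i).
      by move=> si; have := h i; rewrite si /= negbK.
    by case: (perm_arc_next sarc) => [->//|e]; rewrite e eqxx in s2.
  case/andP: si => si nsi.
  rewrite (bigD1 i)//= !mxE eq_sym (negbTE si) mulr0n (negbTE nsi).
  by rewrite subr0 mul0r mulr0.
rewrite addr0 odd_perm1 expr0 mul1r; congr (_ + _).
  rewrite -[n in RHS]card_ord -prodr_const; apply: eq_bigr => i _.
  by rewrite !mxE perm1 eqxx mulr1n arc_irr subr0.
rewrite (bigID (mem c))/= [X in _ * (_ * X)](eq_bigr (fun=> 'X)); last first.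
  move=> i ic; rewrite !mxE next_permE next_notin// eqxx mulr1n.
  by rewrite arc_irr subr0.
rewrite (eq_bigr (fun i => - (sigma S i (next c i))%:P)); last first.
  move=> i ic; rewrite !mxE next_permE eq_sym (negbTE (next_neq _ _ _))// mulr0n.
  by rewrite ac// sub0r.
rewrite prodr_const prodrN (card_uniqP Uc) mulrA.
have -> : #|[pred i | i \notin c]| = (n - size c)%N.
  apply: (@addnI (size c)); rewrite subnKC ?uniq_size_ord//.
  rewrite -[RHS]card_ord -(cardC (mem c)) (card_uniqP Uc); congr addn.
rewrite -mulNr; congr (_ * _); rewrite mulrA odd_next_perm ?(ltnW c1)//.
have -> : \prod_(i in c) (sigma S i (next c i))%:P = (cycle_sign S c)%:P.
  by rewrite -big_uniq//= -rmorph_prod.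
(* The sign of the permutation and the [size c] negated entries together always leave a single
   [-1]. *)
rewrite -(signr_odd _ (size c)); case: (odd _).
  by rewrite !(expr0, expr1, mulN1r, mul1r, opprK).
by rewrite !(expr0, expr1, mulN1r, mul1r).
Qed.

End CharPoly.

(** * The complex roots of [X^m + 1] *)

Section Roots.
Variable R : realType.
Implicit Types x y t : R.

Definition cis t : R[i] := (cos t +i* sin t)%C.

Lemma cisD x y : cis (x + y) = cis x * cis y.
Proof. by rewrite /cis cosD sinD; congr (_ +i* _)%C; rewrite addrC. Qed.

Lemma cisX k t : cis t ^+ k = cis (k%:R * t).
Proof.
elim: k => [|k IH]; first by rewrite expr0 mul0r /cis cos0 sin0.
by rewrite exprS IH -cisD -natr1 mulrDl mul1r addrC.
Qed.

Definition negative_cycle_root m j : R[i] := cis (j.*2.+1%:R * (pi / m%:R)).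

(** Two such roots differ by a rotation through [2u] with [0 < u < pi], and
    [cos(2u) = 1 - 2 sin^2 u] is then below 1. *)
Lemma negative_cycle_root_inj m :
  {in gtn m &, injective (negative_cycle_root m)}.
Proof.
move=> j k; wlog: j k / (j < k)%N => [W jm km e|jk].
  by have [/W->//|/W->//|//] := ltngtP j k.
rewrite !inE => jm km e; exfalso; have pi0 := pi_gt0 R.
have m0 : 0 < m%:R :> R by rewrite ltr0n; lia.
pose u : R := (k - j)%:R * (pi / m%:R).
have su : 0 < sin u.
  have kj0 : 0 < (k - j)%:R :> R by rewrite ltr0n; lia.
  have kjm : (k - j)%:R < m%:R :> R by rewrite ltr_nat; lia.
  apply: sin_gt0_pi; rewrite mulr_gt0 ?divr_gt0//=.
  by rewrite /u mulrCA -[ltRHS]mulr1 ltr_pM2l// ltr_pdivrMr// mul1r.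
move: e; rewrite /negative_cycle_root.
have -> : k.*2.+1%:R * (pi / m%:R) = u *+ 2 + j.*2.+1%:R * (pi / m%:R).
  rewrite mulr2n /u -!mulrDl -!natrD; congr (_%:R * _); lia.
set t := _ * _; rewrite cisD => e.
have t0 : cis t != 0.
  apply/eqP => -[c0 s0]; have := cos2Dsin2 t.
  by rewrite c0 s0 expr0n addr0 => /eqP; rewrite eq_sym oner_eq0.
have [+ _] : cis (u *+ 2) = 1 by apply: (mulIf t0); rewrite mul1r.
by rewrite cos_mulr2n cos2sin2 (mulr2n (_ - _)); nra.
Qed.

(** A monic polynomial of degree [m] with [m] distinct roots splits over them; each is a root since
    [cis pi] to an odd power is [-1]. *)
Lemma XnD1_prod m : (0 < m)%N ->
  'X^m + 1 = \prod_(z <- mkseq (negative_cycle_root m) m) ('X - z%:P) :> {poly R[i]}.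
Proof.
move=> m0; have mR : m%:R != 0 :> R by rewrite pnatr_eq0; lia.
have sX : size ('X^m + 1 : {poly R[i]}) = m.+1.
  by rewrite size_polyDl size_polyXn// size_poly1; lia.
rewrite [LHS](@all_roots_prod_XsubC _ _ (mkseq (negative_cycle_root m) m)).
- rewrite lead_coefDl ?lead_coefXn ?scale1r// size_polyXn size_poly1; lia.
- by rewrite sX size_mkseq.
- apply/allP => _ /mapP[j _ ->]; apply/rootP.
  rewrite hornerD hornerXn hornerC cisX mulrCA (mulrCA m%:R) divff// mulr1.
  have cispi : cis pi = -1.
    by rewrite /cis cospi sinpi; apply/eqP; rewrite eq_complex /= oppr0 !eqxx.
  by rewrite -cisX cispi exprS -mul2n exprM sqrrN !expr1n mulr1 addNr.
- rewrite uniq_rootsE map_inj_in_uniq ?iota_uniq// => j k.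
  rewrite !mem_iota !add0n => jm km; exact: negative_cycle_root_inj.
Qed.

End Roots.

(** * Signs of cycles and energies of sidigraphs *)

Section SidigraphEnergy.
Variable n : nat.
Implicit Type S : sidigraph n.

Lemma cycle_sign_rot S c k : uniq c -> cycle_sign S (rot k c) = cycle_sign S c.
Proof.
move=> Uc; rewrite /cycle_sign (perm_big c) ?perm_rot//=.
by apply: eq_bigr => v _; rewrite next_rot.
Qed.

Lemma cycle_signE S c : dicycle S c ->
  cycle_sign S c = (-1) ^+ count (fun v => sigma S v (next c v) == -1) c.
Proof.
case/and3P => _ ac _; rewrite /cycle_sign.
have {}ac x : x \in c -> Defs.arc S x (next c x) by exact: next_cycle.
(* The induction shortens only the list of vertices; [next c] keeps referring to the whole cycle. *)
have: {subset c <= c} by [].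
elim: {1 3 6}c => [_|x p IH pc]; first by rewrite big_nil.
rewrite big_cons /= exprD IH; last by move=> y yp; rewrite pc// inE yp orbT.
congr (_ * _).
by have [->|->] := sigma_arc (ac x (pc x (mem_head x p))); rewrite ?eqxx.
Qed.

(** Were the sign of the unique cycle [1], all its rotations would be positive too and [S] would be
    balanced. *)
Lemma unicyclic_unbalanced S : unicyclic S -> ~ cycle_balanced S ->
  exists c, [/\ dicycle S c, forall c', dicycle S c' -> exists k, c' = rot k c
              & cycle_sign S c = -1].
Proof.
move=> [c dc uc] nb; exists c; split=> //.
have := cycle_signE dc; rewrite -signr_odd; case: (odd _) => // sc.
case: nb => c' /uc[k ->]; rewrite cycle_sign_rot//; by case/and3P: dc.
Qed.

(** All arcs follow [next c], so any directed cycle is an orbit of [next c], that is, a rotation of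
    [c]. *)
Lemma negative_cycle_unicyclic S : negative_cycle S ->
  exists c, [/\ dicycle S c, size c = n,
    forall c', dicycle S c' -> exists k, c' = rot k c & cycle_sign S c = -1].
Proof.
move=> [c [dc cT aS oc]]; have /and3P[c1 cc Uc] := dc; exists c; split=> //.
- by rewrite -(card_uniqP Uc) -[RHS]card_ord; apply: eq_card => v; rewrite cT.
- move=> c' /and3P[c1' cc' Uc'] {c1 cc}.
  have f' : fcycle (next c) c'.
    by rewrite (eq_cycle (e' := Defs.arc S))// => u v; rewrite aS eq_sym.
  case: c' {cc'} c1' Uc' f' => // x q _ Uc' f'.
  have [j e] := orbit_rot_cycle (cycle_next Uc) Uc (cT x).
  by exists j; rewrite -e (orbitE f' Uc') ?mem_head//= eqxx rot0.
- by rewrite cycle_signE// -signr_odd oc.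
Qed.

Lemma negative_cycle_unicyclic_unbalanced S : negative_cycle S ->
  unicyclic S /\ ~ cycle_balanced S.
Proof.
move=> /negative_cycle_unicyclic[c [dc _ uc sc]]; split; first by exists c.
by move=> /(_ c dc); rewrite sc.
Qed.

Variable R : realType.

(** With [k = size c], the characteristic polynomial is [X^(n-k) (X^k + 1)]. Unique factorization
    makes the eigenvalues [n - k] zeros, which add no energy, and the [k]-th roots of [-1]. *)
Lemma energy_unicyclic S c : dicycle S c ->
    (forall c', dicycle S c' -> exists k, c' = rot k c) -> cycle_sign S c = -1 ->
  energy R S = negative_cycle_energy R (size c).
Proof.
move=> dc uc sc; have /and3P[c1 _ Uc] := dc.
have cn := uniq_size_ord Uc.
rewrite /energy; set A := map_mx _ _.
set r := nseq (n - size c) (0 : R[i]) ++ mkseq (negative_cycle_root R (size c)) (size c).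
have /(perm_big _) -> /= : perm_eq (eigenvalues A) r.
  apply: prod_XsubC_eq; rewrite -eigenvaluesP -map_char_poly (char_poly_unicyclic dc uc).
  rewrite sc big_cat /= -XnD1_prod; last lia.
  rewrite big_nseq iter_mulr_1 subr0 polyCN mulN1r opprK rmorphD /= !map_polyXn.
  by rewrite mulrDr mulr1 -exprD subnK.
rewrite big_cat /= big1_seq ?add0r; last by move=> z /= /nseqP[-> _]; rewrite normr0.
by rewrite big_map /negative_cycle_energy /index_iota subn0.
Qed.

Lemma energy_unicyclic_unbalanced S : unicyclic S -> ~ cycle_balanced S ->
  exists m, [/\ (1 < m)%N, (m <= n)%N & energy R S = negative_cycle_energy R m].
Proof.
move=> uS nS; have [c [dc uc sc]] := unicyclic_unbalanced uS nS.
have /and3P[c1 _ Uc] := dc; exists (size c); split=> //; first exact: uniq_size_ord.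
exact: energy_unicyclic.
Qed.

Lemma energy_negative_cycle S : negative_cycle S ->
  energy R S = negative_cycle_energy R n.
Proof.
move=> /negative_cycle_unicyclic[c [dc sn uc sc]].
by rewrite (energy_unicyclic dc uc sc) sn.
Qed.

End SidigraphEnergy.

Lemma negative_cycle_exists n : (2 <= n)%N -> exists C : sidigraph n, negative_cycle C.
Proof.
case: n => // n n1; pose c := enum 'I_n.+1.
have Uc : uniq c := enum_uniq _.
have sc : size c = n.+1 by rewrite size_enum_ord.
have cT v : v \in c by rewrite mem_enum.
pose a : rel 'I_n.+1 := fun u v => v == next c u.
(* Each vertex has one outgoing arc, so exactly one arc is negative. *)
pose s (u v : 'I_n.+1) : int := if u == ord0 then -1 else 1.
have ai : irreflexive a.
  by move=> u; rewrite /a eq_sym (negbTE (next_neq _ _ _))// sc.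
have sa u v : a u v -> s u v = 1 \/ s u v = -1 by rewrite /s; case: eqP; [right|left].
exists (Sidigraph ai sa), c; split=> //.
  rewrite /dicycle sc n1 Uc andbT /=; apply: cycle_from_next => // x _.
  by rewrite /a /=.
have -> : count (fun v => s v (next c v) == -1) c = count_mem ord0 c.
  by apply: eq_count => v; rewrite /s /=; case: (v == ord0).
by rewrite count_uniq_mem ?cT.
Qed.

(** The first component shows that the extremal bounds are attained: negative cycles exist in every
    order from 2 on and belong to the class compared. *)
Theorem theorem3p1 (R : realType) :
  [/\ (forall n : nat, (2 <= n)%N ->
         exists C : sidigraph n, negative_cycle C)
      /\
      (forall (n : nat) (C : sidigraph n), (2 <= n)%N -> negative_cycle C ->
         unicyclic C /\ ~ cycle_balanced C),
      forall (n : nat) (S C : sidigraph n), (2 <= n)%N ->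
        unicyclic S -> ~ cycle_balanced S -> negative_cycle C ->
        energy R S <= energy R C,
      forall (m n : nat) (Cm : sidigraph m) (Cn : sidigraph n),
        (2 <= m)%N -> (m < n)%N -> negative_cycle Cm -> negative_cycle Cn ->
        energy R Cm < energy R Cn
    & forall (n : nat) (S : sidigraph n) (C2 : sidigraph 2), (2 <= n)%N ->
        unicyclic S -> ~ cycle_balanced S -> negative_cycle C2 ->
        energy R C2 <= energy R S].
Proof.
split; [split=> [n|n C n1 nC]|move=> n S C n1 uS nS nC|
        move=> m n Cm Cn m1 mn nCm nCn|move=> n S C2 n1 uS nS nC].
- exact: negative_cycle_exists.
- exact: negative_cycle_unicyclic_unbalanced.
- have [m [m1 mn ->]] := energy_unicyclic_unbalanced R uS nS.
  rewrite (energy_negative_cycle R nC); exact: negative_cycle_energy_le.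
- rewrite (energy_negative_cycle R nCm) (energy_negative_cycle R nCn).
  exact: negative_cycle_energy_lt.
- have [m [m1 mn ->]] := energy_unicyclic_unbalanced R uS nS.
  rewrite (energy_negative_cycle R nC); exact: negative_cycle_energy_le.
Qed.
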